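(* Let $t\ge 2$ and $v\ge t+1$, and let $(V,\mathcal{B})$ be a Steiner $t$-design $S(t,t+1,v)$. Let $M_{t-1}$ be the binary matrix whose columns correspond to all the blocks of $\mathcal{B}$, whose rows correspond to all $(t-1)$-subsets of $V$, and whose $(i,j)$ entry is $1$ if and only if the $(t-1)$-subset of row $i$ is contained in the block of column $j$ (and is $0$ otherwise). Let $\mathcal{C}$ be the binary linear code with parity-check matrix $M_{t-1}$. Then the rate $R$ of $\mathcal{C}$ satisfies $R\ge 1-\frac{t(t+1)}{v-t+1}$.
   Context: A Steiner $t$-design $S(t,k,v)$ is an ordered pair $(V,\mathcal{B})$ where $|V|=v$ and $\mathcal{B}$ is a collection of $k$-subsets (blocks) of $V$ such that every $t$-subset of $V$ occurs in exactly one block of $\mathcal{B}$. The binary code with parity-check matrix $H$ (with $n$ columns) is $\{\mathbf{x}\in\mathbb{F}_2^n : H\mathbf{x}^T=\mathbf{0}\}$; if it has dimension $k$, its rate is $k/n$. *)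

(* Defs.v *)
From mathcomp Require Import all_boot all_order all_algebra.

Set Implicit Arguments.
Unset Strict Implicit.
Unset Printing Implicit Defensive.

Import GRing.Theory.
Local Open Scope ring_scope.

(* For t <= k a repeated block would put a t-subset in two blocks, so taking
   the collection of blocks to be a set loses nothing. *)
Definition steiner_design (t k v : nat) (V : finType) (B : {set {set V}}) :
    Prop :=
  [/\ #|V| = v,
      forall b : {set V}, b \in B -> #|b| = k
    & forall S : {set V}, #|S| = t ->
        exists! b : {set V}, b \in B /\ S \subset b].

Definition subsets_of_size (V : finType) (s : nat) : {set {set V}} :=
  [set A : {set V} | #|A| == s].

Definition incidence_mx (V : finType) (B : {set {set V}}) (s : nat) :
    'M['F_2]_(#|subsets_of_size V s|, #|B|) :=
  \matrix_(i < #|subsets_of_size V s|, j < #|B|)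
    ((enum_val i : {set V}) \subset (enum_val j : {set V}))%:R.

Definition code_of_parity_check (m n : nat) (H : 'M['F_2]_(m, n)) :
    {vspace 'rV['F_2]_n} :=
  lker (linfun (mulmx H \o trmx : 'rV['F_2]_n -> 'cV['F_2]_m)).

Lemma mem_code_of_parity_check (m n : nat) (H : 'M['F_2]_(m, n))
    (x : 'rV['F_2]_n) :
  (x \in code_of_parity_check H) = (H *m x^T == 0).
Proof. by rewrite memv_ker lfunE. Qed.

Definition code_rate (n : nat) (C : {vspace 'rV['F_2]_n}) : rat :=
  (\dim C)%:R / n%:R.

(* Main.v *)
Require Import Defs.
From mathcomp Require Import all_boot all_order all_algebra.

Import Order.TTheory GRing.Theory Num.Theory.

Local Open Scope ring_scope.

(** The code has dimension at least [#|B| - 'C(v, t - 1)], the number of columns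
    minus the number of rows of its parity-check matrix. Counting the pairs
    ([t]-subset, block containing it) gives [#|B| * (t + 1) = 'C(v, t)], and
    ['C(v, t) * t = 'C(v, t - 1) * (v - t + 1)], so the ratio of rows to columns
    is exactly [t (t + 1) / (v - t + 1)]. *)

Lemma card_subsets_of_size (V : finType) (s : nat) :
  #|subsets_of_size V s| = 'C(#|V|, s).
Proof.
rewrite -cardsT -cards_draws; apply: eq_card => A.
by rewrite !inE subsetT.
Qed.

Lemma card_blocks_bin (t k v : nat) (V : finType) (B : {set {set V}}) :
  steiner_design t k v B -> (#|B| * 'C(k, t) = 'C(v, t))%N.
Proof.
case=> cardV cardB designB; rewrite -cardV -card_subsets_of_size.
(* Grouped by block, each [b] contributes its ['C(k, t)] subsets of size [t]. *)
transitivity (\sum_(b in B) \sum_(S in subsets_of_size V t | S \subset b) 1)%N.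
  rewrite -sum_nat_const; apply: eq_bigr => b bB.
  rewrite sum1_card -(cardB b bB) -cards_draws.
  by apply: eq_card => S; rewrite inE unfold_in inE andbC.
rewrite (exchange_big_dep (mem (subsets_of_size V t))) /=; last by move=> b S _ /andP[].
rewrite -sum1_card; apply: eq_bigr => S St.
(* Grouped by [S], the design axiom leaves a single block, so each inner sum is 1. *)
have [|b [[bB Sb] b_uniq]] := designB S; first by apply/eqP; rewrite inE in St.
rewrite sum1_card -(card1 b); apply: eq_card => c; rewrite !inE.
apply/idP/eqP => [/and3P[cB _ Sc]|->]; first exact/esym/b_uniq.
by rewrite inE in St; apply/and3P.
Qed.

(** Rank-nullity: the code is a kernel, and the image lies in a space of dimension [m]. *)
Lemma dim_code_of_parity_check (m n : nat) (H : 'M['F_2]_(m, n)) :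
  (n <= \dim (code_of_parity_check H) + m)%N.
Proof.
rewrite /code_of_parity_check; set f := linfun _.
have dim_eq := limg_ker_dim f fullv.
rewrite capfv dimvf dim_matrix mul1r in dim_eq.
rewrite -[X in (X <= _)%N]dim_eq leq_add2l.
by rewrite (leq_trans (dimvS (subvf _))) // dimvf dim_matrix mulr1.
Qed.

Theorem proposition3p17 (t v : nat) (V : finType) (B : {set {set V}})
    (ht : (2 <= t)%N) (hv : (t + 1 <= v)%N)
    (hB : steiner_design t (t + 1) v B) :
  code_rate (code_of_parity_check (incidence_mx B (t - 1)))
    >= 1 - (t%:R * (t%:R + 1)) / (v%:R - t%:R + 1) :> rat.
Proof.
have tv : (t < v)%N by rewrite -addn1.
have t_gt0 : (0 < t)%N by apply: ltnW.
have card_eq := card_blocks_bin _ _ _ _ _ hB.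
rewrite addn1 binSn in card_eq.
(* The rate divides by [#|B|], and division by zero in [rat] would give 0. *)
have B_gt0 : (0 < #|B|)%N.
  by have := bin_gt0 v t; rewrite (ltnW tv) -card_eq muln_gt0 => /andP[].
have ratio_eq : (t * t.+1 * #|B| = 'C(v, t - 1) * (v - t).+1)%N.
  have := mul_bin_left v t.-1.
  rewrite prednK // -subn1 -card_eq subnA ?leq_pred // 1?ltnW // addn1.
  by rewrite [RHS]mulnC => <-; rewrite -mulnA [(t.+1 * _)%N]mulnC.
have dim_ge := dim_code_of_parity_check _ _ (incidence_mx B (t - 1)).
have [cardV _ _] := hB.
rewrite [X in (_ <= _ + X)%N]card_subsets_of_size cardV in dim_ge.
have -> : v%:R - t%:R + 1 = (v - t).+1%:R :> rat by rewrite -natr1 natrB // ltnW.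
rewrite /code_rate natr1.
rewrite lerBlDr -lerBlDl -natrM.
have -> : (t * t.+1)%:R / (v - t).+1%:R = ('C(v, t - 1))%:R / #|B|%:R :> rat.
  by apply/eqP; rewrite eqr_div ?pnatr_eq0 -?lt0n // -!natrM ratio_eq.
(* Over the common denominator [#|B|], the bound becomes exactly [dim_ge]. *)
rewrite lerBlDl -mulrDl ler_pdivlMr ?ltr0n // mul1r -natrD ler_nat.
by rewrite addnC in dim_ge *.
Qed.
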